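(* For every set of formulas $\Gamma\cup\{A\}\subseteq For(\Sigma)$: if $\Gamma\models_{\mathcal{M}_6}A$ then $\Gamma\vdash_{LET_K^+}A$.
   Context: $For(\Sigma)$ is the set of formulas over a denumerable set of propositional variables and $\Sigma=\{\land,\lor,\to,\neg,\circ\}$. The logic $LET_K$ is the natural deduction system with rules: ($\land$I) from $A,B$ infer $A\land B$; ($\land$E) from $A\land B$ infer $A$ and $B$; ($\lor$I) from $A$ (or from $B$) infer $A\lor B$; ($\lor$E) from $A\lor B$ and derivations of $C$ from $[A]$ and from $[B]$ infer $C$; ($\neg\land$I) from $\neg A$ (or $\neg B$) infer $\neg(A\land B)$; ($\neg\land$E) from $\neg(A\land B)$ and derivations of $C$ from $[\neg A]$ and from $[\neg B]$ infer $C$; ($\neg\lor$I) from $\neg A,\neg B$ infer $\neg(A\lor B)$; ($\neg\lor$E) from $\neg(A\lor B)$ infer $\neg A$ and $\neg B$; (DN) $A$ and $\neg\neg A$ are inter-derivable; ($\to$I) from a derivation of $B$ from $[A]$ infer $A\to B$; ($\to$E) from $A\to B$ and $A$ infer $B$; ($\to_{CL}$) axiom $A\lor(A\to B)$; ($\neg\to$I) from $A,\neg B$ infer $\neg(A\to B)$; ($\neg\to$E) from $\neg(A\to B)$ infer $A$ and $\neg B$; (EXP$^\circ$) from $\circ A,A,\neg A$ infer $B$; (PEM$^\circ$) from $\circ A$ infer $A\lor\neg A$ (bracketed hypotheses are discharged). Write $A^T$ for $\circ A\land A$, $A^F$ for $\circ A\land\neg A$. $LET_K^+$ adds: (I$\circ$)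 axiom $\circ\circ A$; (I$\neg\circ$) from $\circ A$ infer $\circ\neg A$; (E$\neg\circ$) from $\circ\neg A$ infer $\circ A$; (I$\land$T) from $A^T,B^T$ infer $(A\land B)^T$; (I$\land$F) from $A^F$ (or $B^F$) infer $(A\land B)^F$; (I$\lor$T) from $A^T$ (or $B^T$) infer $(A\lor B)^T$; (I$\lor$F) from $A^F,B^F$ infer $(A\lor B)^F$; (I$\to$T) from $A^F$ (or $B^T$) infer $(A\to B)^T$; (I$\to$F) from $A,B^F$ infer $(A\to B)^F$; (E$\land$T) from $(A\land B)^T$ infer $A^T$ and $B^T$; (E$\land$F) from $(A\land B)^F$ and derivations of $C$ from $[A^F]$ and from $[B^F]$ infer $C$; (E$\lor$T) from $(A\lor B)^T$ and derivations of $C$ from $[A^T]$ and from $[B^T]$ infer $C$; (E$\lor$F) from $(A\lor B)^F$ infer $A^F$ and $B^F$; (E$\to$T) from $(A\to B)^T$ and derivations of $C$ from $[A^F]$ and from $[B^T]$ infer $C$; (E$\to$F) from $(A\to B)^F$ infer $A$ and $B^F$. $\Gamma\vdash_{LET_K^+}A$ means derivability from premises in $\Gamma$. Let $\{0,1\}$ be the two-element Boolean algebra with $\sqcap,\sqcup,\sim$, $a\Rightarrow b=\sim a\sqcup b$. $\mathcal{M}_6$ is the logical matrix with domain $B_{LET_K}=\{z\in\{0,1\}^3:z_3\le z_1\sqcup z_2,\ z_1\sqcap z_2\sqcap z_3=0\}=\{T=(1,0,1),T_0=(1,0,0),\mathsf{b}=(1,1,0),\mathsf{n}=(0,0,0),F_0=(0,1,0),F=(0,1,1)\}$,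 designated set $\mathrm{D}=\{T,T_0,\mathsf{b}\}$, and operations: $z\tilde\land w=(z_1\sqcap w_1,\ z_2\sqcup w_2,\ (z_1\sqcap z_3\sqcap w_1\sqcap w_3)\sqcup(z_2\sqcap z_3)\sqcup(w_2\sqcap w_3))$; $z\tilde\lor w=(z_1\sqcup w_1,\ z_2\sqcap w_2,\ (z_2\sqcap z_3\sqcap w_2\sqcap w_3)\sqcup(z_1\sqcap z_3)\sqcup(w_1\sqcap w_3))$; $z\tilde\to w=(z_1\Rightarrow w_1,\ z_1\sqcap w_2,\ (z_1\sqcap w_2\sqcap w_3)\sqcup(z_2\sqcap z_3)\sqcup(w_1\sqcap w_3))$; $\tilde\neg z=(z_2,z_1,z_3)$; $\tilde\circ z=(z_3,\sim z_3,1)$. A valuation is a homomorphism from the formula algebra into this algebra; $\Gamma\models_{\mathcal{M}_6}A$ iff every valuation sending all formulas of $\Gamma$ into $\mathrm{D}$ sends $A$ into $\mathrm{D}$. *)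

(* Defs.v *)
From mathcomp Require Import all_boot all_order.
From mathcomp Require Import classical_sets.

Set Implicit Arguments.
Unset Strict Implicit.
Unset Printing Implicit Defensive.

Local Open Scope classical_set_scope.

Inductive form : Type :=
| Var of nat
| And of form & form
| Or of form & form
| Imp of form & form
| Neg of form
| Circ of form.

Definition markT (A : form) : form := And (Circ A) A.
Definition markF (A : form) : form := And (Circ A) (Neg A).

(* [G] is the set of available assumptions; a rule that discharges the
   hypothesis [A] has the premise [LETKp (A |` G) _]. Since derivations are
   finite, only finitely many elements of an infinite [G] are ever used.
   The rules up to [pemC] are those of LET_K; LET_K^+ adds the others. *)
Inductive LETKp : set form -> form -> Prop :=
| hyp G A : G A -> LETKp G A
| andI G A B : LETKp G A -> LETKp G B -> LETKp G (And A B)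
| andEl G A B : LETKp G (And A B) -> LETKp G A
| andEr G A B : LETKp G (And A B) -> LETKp G B
| orIl G A B : LETKp G A -> LETKp G (Or A B)
| orIr G A B : LETKp G B -> LETKp G (Or A B)
| orE G A B C : LETKp G (Or A B) ->
    LETKp (A |` G) C -> LETKp (B |` G) C -> LETKp G C
| nandIl G A B : LETKp G (Neg A) -> LETKp G (Neg (And A B))
| nandIr G A B : LETKp G (Neg B) -> LETKp G (Neg (And A B))
| nandE G A B C : LETKp G (Neg (And A B)) ->
    LETKp (Neg A |` G) C -> LETKp (Neg B |` G) C -> LETKp G C
| norI G A B : LETKp G (Neg A) -> LETKp G (Neg B) -> LETKp G (Neg (Or A B))
| norEl G A B : LETKp G (Neg (Or A B)) -> LETKp G (Neg A)
| norEr G A B : LETKp G (Neg (Or A B)) -> LETKp G (Neg B)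
| dnI G A : LETKp G A -> LETKp G (Neg (Neg A))
| dnE G A : LETKp G (Neg (Neg A)) -> LETKp G A
| impI G A B : LETKp (A |` G) B -> LETKp G (Imp A B)
| impE G A B : LETKp G (Imp A B) -> LETKp G A -> LETKp G B
| impCL G A B : LETKp G (Or A (Imp A B))
| nimpI G A B : LETKp G A -> LETKp G (Neg B) -> LETKp G (Neg (Imp A B))
| nimpEl G A B : LETKp G (Neg (Imp A B)) -> LETKp G A
| nimpEr G A B : LETKp G (Neg (Imp A B)) -> LETKp G (Neg B)
| expC G A B : LETKp G (Circ A) -> LETKp G A -> LETKp G (Neg A) -> LETKp G B
| pemC G A : LETKp G (Circ A) -> LETKp G (Or A (Neg A))
| circI G A : LETKp G (Circ (Circ A))
| ncircI G A : LETKp G (Circ A) -> LETKp G (Circ (Neg A))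
| ncircE G A : LETKp G (Circ (Neg A)) -> LETKp G (Circ A)
| andTI G A B : LETKp G (markT A) -> LETKp G (markT B) ->
    LETKp G (markT (And A B))
| andFIl G A B : LETKp G (markF A) -> LETKp G (markF (And A B))
| andFIr G A B : LETKp G (markF B) -> LETKp G (markF (And A B))
| orTIl G A B : LETKp G (markT A) -> LETKp G (markT (Or A B))
| orTIr G A B : LETKp G (markT B) -> LETKp G (markT (Or A B))
| orFI G A B : LETKp G (markF A) -> LETKp G (markF B) ->
    LETKp G (markF (Or A B))
| impTIl G A B : LETKp G (markF A) -> LETKp G (markT (Imp A B))
| impTIr G A B : LETKp G (markT B) -> LETKp G (markT (Imp A B))
| impFI G A B : LETKp G A -> LETKp G (markF B) -> LETKp G (markF (Imp A B))
| andTEl G A B : LETKp G (markT (And A B)) -> LETKp G (markT A)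
| andTEr G A B : LETKp G (markT (And A B)) -> LETKp G (markT B)
| andFE G A B C : LETKp G (markF (And A B)) ->
    LETKp (markF A |` G) C -> LETKp (markF B |` G) C -> LETKp G C
| orTE G A B C : LETKp G (markT (Or A B)) ->
    LETKp (markT A |` G) C -> LETKp (markT B |` G) C -> LETKp G C
| orFEl G A B : LETKp G (markF (Or A B)) -> LETKp G (markF A)
| orFEr G A B : LETKp G (markF (Or A B)) -> LETKp G (markF B)
| impTE G A B C : LETKp G (markT (Imp A B)) ->
    LETKp (markF A |` G) C -> LETKp (markT B |` G) C -> LETKp G C
| impFEl G A B : LETKp G (markF (Imp A B)) -> LETKp G A
| impFEr G A B : LETKp G (markF (Imp A B)) -> LETKp G (markF B).

Definition triple : Type := (bool * bool * bool)%type.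

(* [<=] is the order of the two-element Boolean algebra [bool]. *)
Definition in_B6 (z : triple) : bool :=
  let: (z1, z2, z3) := z in
  (z3 <= z1 || z2)%O && (z1 && z2 && z3 == false).

Definition B6 : Type := {z : triple | in_B6 z}.

Definition and3b (z w : triple) : triple :=
  let: (z1, z2, z3) := z in let: (w1, w2, w3) := w in
  (z1 && w1, z2 || w2, (z1 && z3 && w1 && w3) || (z2 && z3) || (w2 && w3)).

Definition or3b (z w : triple) : triple :=
  let: (z1, z2, z3) := z in let: (w1, w2, w3) := w in
  (z1 || w1, z2 && w2, (z2 && z3 && w2 && w3) || (z1 && z3) || (w1 && w3)).

Definition imp3b (z w : triple) : triple :=
  let: (z1, z2, z3) := z in let: (w1, w2, w3) := w in
  (~~ z1 || w1, z1 && w2, (z1 && w2 && w3) || (z2 && z3) || (w1 && w3)).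

Definition neg3b (z : triple) : triple := let: (z1, z2, z3) := z in (z2, z1, z3).

Definition circ3b (z : triple) : triple :=
  let: (_, _, z3) := z in (z3, ~~ z3, true).

Lemma and3b_closed z w : in_B6 z -> in_B6 w -> in_B6 (and3b z w).
Proof. by move: z w => [[[] []] []] [[[] []] []]. Qed.

Lemma or3b_closed z w : in_B6 z -> in_B6 w -> in_B6 (or3b z w).
Proof. by move: z w => [[[] []] []] [[[] []] []]. Qed.

Lemma imp3b_closed z w : in_B6 z -> in_B6 w -> in_B6 (imp3b z w).
Proof. by move: z w => [[[] []] []] [[[] []] []]. Qed.

Lemma neg3b_closed z : in_B6 z -> in_B6 (neg3b z).
Proof. by move: z => [[[] []] []]. Qed.

Lemma circ3b_closed z : in_B6 z -> in_B6 (circ3b z).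
Proof. by move: z => [[[] []] []]. Qed.

Definition and6 (z w : B6) : B6 :=
  exist _ (and3b (val z) (val w)) (and3b_closed (valP z) (valP w)).
Definition or6 (z w : B6) : B6 :=
  exist _ (or3b (val z) (val w)) (or3b_closed (valP z) (valP w)).
Definition imp6 (z w : B6) : B6 :=
  exist _ (imp3b (val z) (val w)) (imp3b_closed (valP z) (valP w)).
Definition neg6 (z : B6) : B6 :=
  exist _ (neg3b (val z)) (neg3b_closed (valP z)).
Definition circ6 (z : B6) : B6 :=
  exist _ (circ3b (val z)) (circ3b_closed (valP z)).

Definition valT : B6 := exist _ (true, false, true) isT.
Definition valT0 : B6 := exist _ (true, false, false) isT.
Definition valb : B6 := exist _ (true, true, false) isT.
Definition valn : B6 := exist _ (false, false, false) isT.
Definition valF0 : B6 := exist _ (false, true, false) isT.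
Definition valF : B6 := exist _ (false, true, true) isT.

Lemma B6_enum (z : B6) : z \in [:: valT; valT0; valb; valn; valF0; valF].
Proof. by case: z => [[[[] []] []] ?]. Qed.

Definition D6 : set B6 := [set valT; valT0; valb].

Definition valuation (v : form -> B6) : Prop :=
  [/\ forall A B, v (And A B) = and6 (v A) (v B),
      forall A B, v (Or A B) = or6 (v A) (v B),
      forall A B, v (Imp A B) = imp6 (v A) (v B),
      forall A, v (Neg A) = neg6 (v A)
    & forall A, v (Circ A) = circ6 (v A)].

Definition M6_entails (G : set form) (A : form) : Prop :=
  forall v, valuation v -> (forall B, G B -> D6 (v B)) -> D6 (v A).

(* Main.v *)
(** Canonical model construction. If [A] is not derivable from [Gamma], Zorn's
    lemma gives a maximal extension [D] of [Gamma] that does not derive [A];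
    such a [D] is a prime theory. The map sending [B] to the triple of truth
    values of [D B], [D (Neg B)], [D (Circ B)] is then a valuation: the
    propagation rules of LET_K^+ compute the third coordinate, since [Circ B]
    splits into [markT B] or [markF B] by [pemC]. *)
Require Import Defs.
From mathcomp Require Import all_boot all_order.
From mathcomp Require Import boolp classical_sets.

Set Implicit Arguments.
Unset Strict Implicit.
Unset Printing Implicit Defensive.

Local Open Scope classical_set_scope.

(** * Weakening, cut and derivability along chains *)

Lemma LETKp_weaken (G H : set form) (A : form) :
  G `<=` H -> LETKp G A -> LETKp H A.
Proof.
move=> GH d; elim: d H GH => {G A};
  by [move=> G A GA H GH; apply: hyp; exact: GH
     | intros; econstructor; eauto using setUS].
Qed.

Lemma LETKp_cut (G : set form) (A B : form) :
  LETKp G B -> LETKp (B |` G) A -> LETKp G A.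
Proof. by move=> GB /impI GBA; exact: impE GBA GB. Qed.

Definition chain (I : Type) (X : I -> set form) : Prop :=
  forall i j, X i `<=` X j \/ X j `<=` X i.

Lemma chain_setU (I : Type) (X : I -> set form) (S : set form) :
  chain X -> chain (fun i => S `|` X i).
Proof. by move=> cX i j; case: (cX i j) => /(@setUS _ S); [left|right]. Qed.

(** The premises of a rule may become derivable at different stages of a chain;
    unlike mere existence of a stage, this notion commutes with conjunction. *)
Definition eventually (I : Type) (X : I -> set form) (P : set form -> Prop) :=
  exists i, forall j, X i `<=` X j -> P (X j).

Lemma eventually_and (I : Type) (X : I -> set form) (P Q : set form -> Prop) :
  chain X -> eventually X P -> eventually X Q ->
  eventually X (fun H => P H /\ Q H).
Proof.
move=> cX [i Pi] [j Qj]; case: (cX i j) => XX.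
- exists j => k jk; split; [apply: Pi; exact: subset_trans jk | exact: Qj].
- exists i => k ik; split; [exact: Pi | apply: Qj; exact: subset_trans ik].
Qed.

Lemma eventually_mono (I : Type) (X : I -> set form) (P Q : set form -> Prop) :
  (forall H, P H -> Q H) -> eventually X P -> eventually X Q.
Proof. by move=> PQ [i Pi]; exists i => j /Pi /PQ. Qed.

Lemma eventually_setU (I : Type) (X : I -> set form) (S : set form)
    (P : set form -> Prop) :
  eventually (fun i => S `|` X i) P -> eventually X (fun H => P (S `|` H)).
Proof. by move=> [i Pi]; exists i => j ij; apply: Pi; exact: setUS. Qed.

Lemma bigcup_setU (I : Type) (X : I -> set form) (S G : set form) :
  inhabited I -> G `<=` \bigcup_i X i -> S `|` G `<=` \bigcup_i (S `|` X i).
Proof.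
move=> [i0] GX B [SB|/GX [i _ XB]]; first by exists i0 => //; left.
by exists i => //; right.
Qed.

(** Finiteness of derivations, in the form that Zorn's lemma needs. The chain is quantified inside
    the induction because a premise that discharges a hypothesis uses its induction hypothesis on
    the chain enlarged by that hypothesis. *)
Lemma LETKp_chain (G : set form) (A : form) : LETKp G A ->
  forall (I : Type) (X : I -> set form), inhabited I -> chain X ->
  G `<=` \bigcup_i X i -> eventually X (fun H => LETKp H A).
Proof.
elim=> {G A}.
- move=> G A GA I X _ _ /(_ _ GA) [i _ XA].
  by exists i => j /(_ _ XA); exact: hyp.
(* The two axioms have no premise to supply a stage, so the stage comes from [inhabited I]. *)
17: by move=> G A B I X [i] *; exists i => j _; exact: impCL.
22: by move=> G A I X [i] *; exists i => j _; exact: circI.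
all: move=> *.
all: match goal with iI : inhabited ?I, cX : @chain ?I ?X,
       GX : ?G `<=` _ |- _ =>
  repeat match goal with
  | IH : forall J Y, _ -> _ -> G `<=` _ -> _ |- _ =>
      have {}IH := IH I X iI cX GX
  | IH : forall J Y, _ -> _ -> ?S `|` G `<=` _ -> _ |- _ =>
      have {}IH := eventually_setU
        (IH I _ iI (chain_setU S cX) (bigcup_setU iI GX))
  end;
  repeat match goal with E1 : eventually X _, E2 : eventually X _ |- _ =>
    have {E2}E1 := eventually_and cX E1 E2 end
end.
all: match goal with E : eventually _ _ |- _ =>
  apply: (eventually_mono _ E) => H /= ?; intuition end.
all: by econstructor; eauto.
Qed.

(** * Maximal underivable sets and prime theories *)

Lemma maximal_underivable (G : set form) (A : form) : ~ LETKp G A ->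
  exists D, [/\ G `<=` D, ~ LETKp D A
              & forall B, ~ D B -> LETKp (B |` D) A].
Proof.
(* [G] is joined to [D] inside [P] instead of being required to lie in [D]: the empty chain has
   union [set0], which need not contain [G]. *)
move=> nGA; pose P D := ~ LETKp (G `|` D) A.
have [|D [PD maxD]] := @Zorn_bigcup _ P.
  move=> F FP totF dA.
  (* [set0] makes the chain nonempty. *)
  pose J := {X | (set0 |` F) X}; pose X (i : J) := G `|` sval i.
  have iJ : inhabited J by split; exists set0; left.
  have cX : chain X.
    apply: chain_setU => -[Y FY] [Z FZ] /=.
    case: FY FZ => [->|FY] [->|FZ];
      try by [left; exact: sub0set|right; exact: sub0set].
    by case: (totF _ _ FY FZ); [left|right].
  have [|i] := LETKp_chain dA iJ cX.
    move=> B [GB|[Y FY YB]].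
      by case: iJ => i; exists i => //; left.
    have JY : (set0 |` F) Y by right.
    by exists (exist _ Y JY) => //; right.
  (* [A] is already derivable at the single stage [i], which is either [set0], against [nGA], or a
     member of [F], against [FP]. *)
  move=> /(_ i (fun _ => id)); rewrite /X; case: i => Y JY /=.
  by case: JY => [->|/FP//]; rewrite setU0.
exists (G `|` D); split=> //.
move=> B nB; apply: contrapT => nBA; apply: (maxD (B |` D)).
- split; first by move=> C; right.
  by move=> /(_ B (or_introl erefl)) DB; apply: nB; right.
- by rewrite /P setUCA.
Qed.

Definition prime_theory (D : set form) : Prop :=
  [/\ forall B, LETKp D B -> D B,
      exists B, ~ D B
    & forall B C, D (Or B C) -> D B \/ D C].

(** Closure is cut played against maximality. For primeness, if [B] and [C] are both outside [D],
    each of them added to [D] derives [A], and [orE] then derives [A] from [D] itself. *)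
Lemma maximal_prime (D : set form) (A : form) : ~ LETKp D A ->
  (forall B, ~ D B -> LETKp (B |` D) A) -> prime_theory D.
Proof.
move=> nDA maxD; split.
- move=> B DB; apply: contrapT => /maxD /(LETKp_cut DB); exact: nDA.
- by exists A => /(@hyp _ _).
- move=> B C /(@hyp _ _) DBC; apply: contrapT => /not_orP [/maxD dB /maxD dC].
  exact/nDA/(orE DBC).
Qed.

(** * Connectives inside a prime theory *)

Lemma prime_and (D : set form) (A B : form) : prime_theory D ->
  D (And A B) <-> D A /\ D B.
Proof.
move=> [cl _ _]; split=> [/(@hyp _ _) d|[/(@hyp _ _) a /(@hyp _ _) b]].
- by split; apply: cl; [exact: andEl d|exact: andEr d].
- exact/cl/andI.
Qed.

Lemma prime_or (D : set form) (A B : form) : prime_theory D ->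
  D (Or A B) <-> D A \/ D B.
Proof.
move=> [cl _ pr]; split=> [/pr//|[] /(@hyp _ _) d]; apply: cl.
- exact: orIl.
- exact: orIr.
Qed.

Lemma prime_imp (D : set form) (A B : form) : prime_theory D ->
  D (Imp A B) <-> ~ D A \/ D B.
Proof.
move=> [cl _ pr]; split=> [/(@hyp _ _) d|[nA|/(@hyp _ _) b]].
- have [a|nA] := pselect (D A); last by left.
  by right; apply: cl; apply: impE d _; exact: hyp.
(* Primeness applied to the axiom [Or A (Imp A B)] makes the implication classical. *)
- by case: (pr A (Imp A B)) => //; exact/cl/impCL.
- by apply/cl/impI/(LETKp_weaken _ b) => C; right.
Qed.

Lemma prime_nand (D : set form) (A B : form) : prime_theory D ->
  D (Neg (And A B)) <-> D (Neg A) \/ D (Neg B).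
Proof.
move=> [cl _ pr]; split=> [/(@hyp _ _) d|[] /(@hyp _ _) d].
(* The elimination rule is used with the disjunction of its two cases as conclusion, which primeness
   then splits; the later case-splitting eliminations follow the same pattern. *)
- apply/pr/cl/(nandE d); [apply: orIl|apply: orIr]; apply: hyp; by left.
- exact/cl/nandIl.
- exact/cl/nandIr.
Qed.

Lemma prime_nor (D : set form) (A B : form) : prime_theory D ->
  D (Neg (Or A B)) <-> D (Neg A) /\ D (Neg B).
Proof.
move=> [cl _ _]; split=> [/(@hyp _ _) d|[/(@hyp _ _) a /(@hyp _ _) b]].
- by split; apply: cl; [exact: norEl d|exact: norEr d].
- exact/cl/norI.
Qed.

Lemma prime_nimp (D : set form) (A B : form) : prime_theory D ->
  D (Neg (Imp A B)) <-> D A /\ D (Neg B).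
Proof.
move=> [cl _ _]; split=> [/(@hyp _ _) d|[/(@hyp _ _) a /(@hyp _ _) b]].
- by split; apply: cl; [exact: nimpEl d|exact: nimpEr d].
- exact/cl/nimpI.
Qed.

Lemma prime_nneg (D : set form) (A : form) : prime_theory D ->
  D (Neg (Neg A)) <-> D A.
Proof.
by move=> [cl _ _]; split=> /(@hyp _ _) d; apply: cl; [exact: dnE|exact: dnI].
Qed.

Lemma prime_circ_neg (D : set form) (A : form) : prime_theory D ->
  D (Circ (Neg A)) <-> D (Circ A).
Proof.
by move=> [cl _ _]; split=> /(@hyp _ _) d; apply: cl;
  [exact: ncircE|exact: ncircI].
Qed.

Lemma prime_circ_circ (D : set form) (A : form) :
  prime_theory D -> D (Circ (Circ A)).
Proof. by move=> [cl _ _]; exact/cl/circI. Qed.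

Lemma prime_circ_cases (D : set form) (A : form) : prime_theory D ->
  D (Circ A) -> D A \/ D (Neg A).
Proof. by move=> [cl _ pr] /(@hyp _ _) d; exact/pr/cl/pemC. Qed.

Lemma prime_circ_consistent (D : set form) (A : form) : prime_theory D ->
  D A -> D (Neg A) -> ~ D (Circ A).
Proof.
move=> [cl [B nB] _] /(@hyp _ _) a /(@hyp _ _) na /(@hyp _ _) c.
by apply/nB/cl; exact: expC c a na.
Qed.

(** Since [Circ (Circ A)] always lies in [D], [pemC] and [expC] make [Circ A] behave classically. *)
Lemma prime_ncirc (D : set form) (A : form) : prime_theory D ->
  D (Neg (Circ A)) <-> ~ D (Circ A).
Proof.
move=> pD; have cc := prime_circ_circ A pD; split.
- by move=> nc c; exact: (prime_circ_consistent pD c nc cc).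
- by case: (prime_circ_cases pD cc).
Qed.

Lemma prime_circ_marks (D : set form) (A : form) : prime_theory D ->
  D (Circ A) <-> D (markT A) \/ D (markF A).
Proof.
move=> pD; split=> [c|[] /(prime_and _ _ pD) []//].
by case: (prime_circ_cases pD c) => d; [left|right]; apply/(prime_and _ _ pD).
Qed.

(** The disjuncts match, in order, the three terms of the third coordinate of [and3b]. For [Or] the
    two marks exchange roles. *)
Lemma prime_circ_and (D : set form) (A B : form) : prime_theory D ->
  D (Circ (And A B)) <->
  D (markT A) /\ D (markT B) \/ D (markF A) \/ D (markF B).
Proof.
move=> pD; apply: iff_trans (prime_circ_marks _ pD) _; case: pD => cl _ pr.
split=> [[] /(@hyp _ _) d|[[/(@hyp _ _) a /(@hyp _ _) b]|[] /(@hyp _ _) d]].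
- by left; split; apply: cl; [exact: andTEl d|exact: andTEr d].
- right; apply/pr/cl/(andFE d); [apply: orIl|apply: orIr]; apply: hyp; by left.
- by left; exact/cl/andTI.
- by right; exact/cl/andFIl.
- by right; exact/cl/andFIr.
Qed.

Lemma prime_circ_or (D : set form) (A B : form) : prime_theory D ->
  D (Circ (Or A B)) <->
  D (markF A) /\ D (markF B) \/ D (markT A) \/ D (markT B).
Proof.
move=> pD; apply: iff_trans (prime_circ_marks _ pD) _; case: pD => cl _ pr.
split=> [[] /(@hyp _ _) d|[[/(@hyp _ _) a /(@hyp _ _) b]|[] /(@hyp _ _) d]].
- right; apply/pr/cl/(orTE d); [apply: orIl|apply: orIr]; apply: hyp; by left.
- by left; split; apply: cl; [exact: orFEl d|exact: orFEr d].
- by right; exact/cl/orFI.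
- by left; exact/cl/orTIl.
- by left; exact/cl/orTIr.
Qed.

(** The first disjunct has [D A] and not [D (markT A)], as in the rules [impFI] and [impFEl] and in
    the term of [imp3b] that omits [z3]. *)
Lemma prime_circ_imp (D : set form) (A B : form) : prime_theory D ->
  D (Circ (Imp A B)) <->
  D A /\ D (markF B) \/ D (markF A) \/ D (markT B).
Proof.
move=> pD; apply: iff_trans (prime_circ_marks _ pD) _; case: pD => cl _ pr.
split=> [[] /(@hyp _ _) d|[[/(@hyp _ _) a /(@hyp _ _) b]|[] /(@hyp _ _) d]].
- right; apply/pr/cl/(impTE d); [apply: orIl|apply: orIr]; apply: hyp; by left.
- by left; split; apply: cl; [exact: impFEl d|exact: impFEr d].
- by right; exact/cl/impFI.
- by left; exact/cl/impTIl.
- by left; exact/cl/impTIr.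
Qed.

(** * The canonical valuation *)

Definition canonical_triple (D : set form) (A : form) : triple :=
  (`[< D A >], `[< D (Neg A) >], `[< D (Circ A) >]).

(** The two constraints that define the domain are the semantic counterparts of [pemC] and
    [expC]. *)
Lemma canonical_triple_in_B6 (D : set form) (A : form) :
  prime_theory D -> in_B6 (canonical_triple D A).
Proof.
move=> pD; have := @prime_circ_cases D A pD.
have := @prime_circ_consistent D A pD.
rewrite /in_B6 /canonical_triple.
by do 3 case: asboolP => ? //=; tauto.
Qed.

Definition canonical_val (D : set form) (pD : prime_theory D) (A : form) : B6 :=
  exist _ (canonical_triple D A) (canonical_triple_in_B6 A pD).

Lemma canonical_valuation (D : set form) (pD : prime_theory D) :
  valuation (canonical_val pD).
Proof.
split=> [A B|A B|A B|A|A]; apply: val_inj; rewrite /= /canonical_triple /=;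
  congr (_, _, _); rewrite -?asbool_neg -?asbool_and -?asbool_or.
(* Each coordinate becomes an equivalence about membership in [D], except the third one for [Circ],
   which is the constant [true]. *)
all: try apply: asbool_equiv_eq.
- exact: prime_and.
- exact: prime_nand.
- apply: iff_trans (prime_circ_and _ _ pD) _; rewrite !prime_and //; tauto.
- exact: prime_or.
- exact: prime_nor.
- apply: iff_trans (prime_circ_or _ _ pD) _; rewrite !prime_and //; tauto.
- exact: prime_imp.
- exact: prime_nimp.
- apply: iff_trans (prime_circ_imp _ _ pD) _; rewrite !prime_and //; tauto.
- exact: prime_nneg.
- exact: prime_circ_neg.
- exact: prime_ncirc.
- by apply: asboolT; exact: prime_circ_circ.
Qed.

(** The first coordinate of [canonical_val] records membership in [D], so this identifies the
    formulas it designates with the members of [D]. *)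
Lemma D6_fst (z : B6) : D6 z <-> (val z).1.1.
Proof.
split=> [[[->|->]|->] //|]; have := B6_enum z; rewrite !inE.
move=> /or4P [/eqP->|/eqP->|/eqP->|/or3P [] /eqP->] //= _.
- by left; left.
- by left; right.
- by right.
Qed.

Lemma canonical_val_D6 (D : set form) (pD : prime_theory D) (A : form) :
  D6 (canonical_val pD A) <-> D A.
Proof. by rewrite D6_fst /=; split=> /asboolP. Qed.

Theorem theorem3p15 (Gamma : set form) (A : form) :
  M6_entails Gamma A -> LETKp Gamma A.
Proof.
move=> GA; apply: contrapT => /maximal_underivable [D [GD nDA maxD]].
have pD := maximal_prime nDA maxD.
apply: nDA; apply: hyp; apply/(canonical_val_D6 pD).
apply: GA => [|B /GD]; first exact: canonical_valuation.
by rewrite canonical_val_D6.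
Qed.
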